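(* Let $A=(a_{ij})_{m\times n}$ have entries in $[0,1]$, let $b=(b_i)_{m\times 1}$ have entries in $[0,1]$, and let $\lambda>0$. Let $S$ be the solution set of the max-Dombi fuzzy relational system $A\varphi x=b$. With $\bar{E}$, $\underline{X}(e)$ and $\bar{X}$ as defined in the context, $$S=\bigcup_{e\in\bar{E}}[\underline{X}(e),\bar{X}].$$
   Context: Let $I=\{1,\dots,m\}$, $J=\{1,\dots,n\}$. For $\lambda>0$ the Dombi t-norm $\varphi:[0,1]^2\to[0,1]$ is $\varphi(x,y)=0$ if $x=0$ or $y=0$, and otherwise $$\varphi(x,y)=\left(1+\left[\left(\tfrac{1-x}{x}\right)^{\lambda}+\left(\tfrac{1-y}{y}\right)^{\lambda}\right]^{1/\lambda}\right)^{-1}.$$ For $x\in[0,1]^n$, the system $A\varphi x=b$ means $\max_{j\in J}\varphi(a_{ij},x_j)=b_i$ for all $i\in I$. Put $S=\{x\in[0,1]^n : A\varphi x=b\}$. Vectors are ordered componentwise, and $[u,v]=\{x\in[0,1]^n : u\le x\le v\}$. For $i\in I$ let $J_i=\{j\in J : a_{ij}\ge b_i\}$. For $i\in I$ with $b_i\neq 0$ and $j\in J_i$ let $$V(b_i,a_{ij})=\left(1+\left[\left(\tfrac{1-b_i}{b_i}\right)^{\lambda}-\left(\tfrac{1-a_{ij}}{a_{ij}}\right)^{\lambda}\right]^{1/\lambda}\right)^{-1}.$$ For $i\in I$ define $\hat{x}_i\in[0,1]^n$ by: $(\hat{x}_i)_j=V(b_i,a_{ij})$ if $j\in J_i$ and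 $b_i\neq 0$; $(\hat{x}_i)_j=0$ if $j\in J_i$ and $a_{ij}>b_i=0$; $(\hat{x}_i)_j=1$ otherwise. Let $\bar{X}=\min_{i\in I}\hat{x}_i$ (componentwise minimum). For $i\in I$ and $j\in J_i$ define $\breve{x}_i(j)\in[0,1]^n$ by $\breve{x}_i(j)_k=V(b_i,a_{ik})$ if $b_i\neq 0$ and $k=j$, and $\breve{x}_i(j)_k=0$ otherwise ($k\in J$). For a function $e$ on $I$ with $e(i)\in J_i$ for all $i\in I$, define $\underline{X}(e)\in[0,1]^n$ by $\underline{X}(e)_j=\max_{i\in I}\breve{x}_i(e(i))_j$ for $j\in J$. The matrix $\bar{A}=(\bar{a}_{ij})_{m\times n}$ is obtained from $A$ by setting $\bar{a}_{ij}=0$ whenever one of the following holds, and $\bar{a}_{ij}=a_{ij}$ otherwise: (I) $j\notin J_i$; (II) $j\in J_i$, $b_i\neq 0$, and there is $i'\in I$, $i'\neq i$, with $j\in J_{i'}$, $b_{i'}\neq 0$ and $V(b_{i'},a_{i'j})<V(b_i,a_{ij})$; (III) $j\in J_i$, $b_i\neq 0$, and there is $i'\in I$, $i'\neq i$, with $b_{i'}=0$ and $a_{i'j}>0$. Let $\bar{J}_i=\{j\in J : \bar{a}_{ij}\ge b_i\}$, and let $\bar{E}$ be the set of all functions $e:I\to\bigcup_{i\in I}\bar{J}_i$ with $e(i)\in\bar{J}_i$ for all $i\in I$. (One has $\bar{J}_i\subseteq J_i$, so $\underline{X}(e)$ is defined for $e\in\bar{E}$.) *)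

(* Defs.v *)
From mathcomp Require Import all_boot all_order all_algebra.
From mathcomp Require Import classical_sets reals exp.

Set Implicit Arguments.
Unset Strict Implicit.
Unset Printing Implicit Defensive.

Import Order.TTheory GRing.Theory Num.Theory.
Local Open Scope classical_set_scope.
Local Open Scope ring_scope.

(* Real powers are powR; for lambda > 0 it satisfies 0 `^ lambda = 0. *)
Definition dombi (R : realType) (lambda x y : R) : R :=
  if (x == 0) || (y == 0) then 0
  else (1 + (((1 - x) / x) `^ lambda + ((1 - y) / y) `^ lambda)
              `^ lambda^-1)^-1.

(* Only meaningful for 0 < b <= a <= 1, where the base of the outer power
   is nonnegative. *)
Definition dombiV (R : realType) (lambda b a : R) : R :=
  (1 + (((1 - b) / b) `^ lambda - ((1 - a) / a) `^ lambda) `^ lambda^-1)^-1.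

Definition cube (R : realType) (n : nat) : set 'cV[R]_n :=
  [set x | forall j, 0 <= x j ord0 <= 1].

Definition lecv (R : realType) (n : nat) (u v : 'cV[R]_n) : Prop :=
  forall j, u j ord0 <= v j ord0.

Definition box (R : realType) (n : nat) (u v : 'cV[R]_n) : set 'cV[R]_n :=
  [set x | [/\ cube x, lecv u x & lecv x v]].

Section MaxDombi.
Context {R : realType} {m n : nat}.
Variables (lambda : R) (A : 'M[R]_(m, n)) (b : 'cV[R]_m).

(* As all quantities lie in [0, 1], the initial values 0 of the maxima and 1
   of the minima do not affect maxima and minima over nonempty index sets. *)
Definition maxdombi (x : 'cV[R]_n) : 'cV[R]_m :=
  \col_i \big[Num.max/0]_(j < n) dombi lambda (A i j) (x j ord0).

Definition solutions : set 'cV[R]_n :=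
  [set x | cube x /\ maxdombi x = b].

Definition Jset (i : 'I_m) : {set 'I_n} := finset (fun j => b i ord0 <= A i j).

Definition xhat (i : 'I_m) : 'cV[R]_n :=
  \col_j if (j \in Jset i) && (b i ord0 != 0) then dombiV lambda (b i ord0) (A i j)
         else if [&& j \in Jset i, b i ord0 < A i j & b i ord0 == 0] then 0
         else 1.

Definition Xmax : 'cV[R]_n :=
  \col_j \big[Num.min/1]_(i < m) xhat i j ord0.

(* Used only for j \in Jset i. *)
Definition xbreve (i : 'I_m) (j : 'I_n) : 'cV[R]_n :=
  \col_k if (b i ord0 != 0) && (k == j) then dombiV lambda (b i ord0) (A i k)
         else 0.

Definition Xmin (e : 'I_m -> 'I_n) : 'cV[R]_n :=
  \col_j \big[Num.max/0]_(i < m) xbreve i (e i) j ord0.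

Definition reducible (i : 'I_m) (j : 'I_n) : bool :=
  [|| j \notin Jset i,
      [&& j \in Jset i, b i ord0 != 0 &
        [exists i' : 'I_m, [&& i' != i, j \in Jset i', b i' ord0 != 0 &
          dombiV lambda (b i' ord0) (A i' j) < dombiV lambda (b i ord0) (A i j)]]]
    | [&& j \in Jset i, b i ord0 != 0 &
        [exists i' : 'I_m, [&& i' != i, b i' ord0 == 0 & 0 < A i' j]]]].

Definition Abar : 'M[R]_(m, n) :=
  \matrix_(i, j) if reducible i j then 0 else A i j.

Definition Jbar (i : 'I_m) : {set 'I_n} :=
  finset (fun j => b i ord0 <= Abar i j).

(* The membership condition makes e a function into the union of the Jbar i. *)
Definition Ebar : set ('I_m -> 'I_n) := [set e | forall i, e i \in Jbar i].

End MaxDombi.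

(* Main.v *)
Require Import Defs.
From mathcomp Require Import all_boot all_order all_algebra.
From mathcomp Require Import classical_sets reals exp.
Import Order.TTheory GRing.Theory Num.Theory.
Local Open Scope classical_set_scope.
Local Open Scope ring_scope.

(** With the additive generator G x = ((1 - x) / x)^lambda, a decreasing
  bijection from ]0, 1] onto [0, +oo[, the Dombi t-norm is G^-1 (G x + G y) and
  V(b, a) = G^-1 (G b - G a).  Hence, for 0 < b <= a <= 1, comparing phi(a, x)
  with b amounts to comparing x with V(b, a).  Consequently x <= Xmax expresses
  that no term exceeds its right-hand side, and Xmin e <= x that each equation
  with b_i <> 0 is attained at index e i.  An index where a solution attains an
  equation is never reducible, since there x_j = V(b_i, a_ij) while any
  competing equation would bound x_j strictly below that value. *)

(** Since division by zero yields 0, the value at [x = 0] is 0 and not the limit +oo; this is why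
    zero arguments are split off wherever the generator is used. *)
Definition dombi_gen {R : realType} (lambda x : R) : R :=
  ((1 - x) / x) `^ lambda.

Definition dombi_geninv {R : realType} (lambda t : R) : R :=
  (1 + t `^ lambda^-1)^-1.

Lemma odds_ge0 {R : realType} (x : R) : 0 < x <= 1 -> 0 <= (1 - x) / x.
Proof. by case/andP=> x0 x1; rewrite divr_ge0 ?subr_ge0 // ltW. Qed.

Lemma dombi_gen_ge0 {R : realType} (lambda x : R) : 0 <= dombi_gen lambda x.
Proof. exact: powR_ge0. Qed.

Lemma dombi_genK {R : realType} {lambda x : R} :
  0 < lambda -> 0 < x <= 1 -> dombi_geninv lambda (dombi_gen lambda x) = x.
Proof.
move=> l0 x01; have /andP[x0 _] := x01.
rewrite /dombi_geninv /dombi_gen -powRrM divff ?gt_eqF // powRr1 ?odds_ge0 //.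
by rewrite mulrBl mul1r divff ?gt_eqF // addrC subrK invrK.
Qed.

Lemma dombi_geninv_gt0 {R : realType} (lambda t : R) :
  0 < dombi_geninv lambda t.
Proof. by rewrite invr_gt0 ltr_wpDr ?powR_ge0. Qed.

Lemma ler_dombi_geninv {R : realType} {lambda : R} : 0 < lambda ->
  {in Num.nneg &, {mono dombi_geninv lambda : s t /~ s <= t}}.
Proof.
move=> l0 s t s0 t0.
have pos u : 1 + u `^ lambda^-1 \is Num.pos.
  by rewrite posrE ltr_wpDr ?powR_ge0.
rewrite /dombi_geninv lef_pV2 // lerD2l.
have linv0 : 0 < lambda^-1 by rewrite invr_gt0.
exact: (le_mono_in (gt0_ltr_powR linv0)).
Qed.

Lemma ler_dombi_gen {R : realType} {lambda x y : R} : 0 < lambda ->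
  0 < x <= 1 -> 0 < y <= 1 ->
  (dombi_gen lambda x <= dombi_gen lambda y) = (y <= x).
Proof.
move=> l0 x01 y01.
by rewrite -(ler_dombi_geninv l0) ?nnegrE ?dombi_gen_ge0 // !dombi_genK.
Qed.

Lemma dombiE {R : realType} (lambda a x : R) : 0 < a -> 0 < x ->
  dombi lambda a x
  = dombi_geninv lambda (dombi_gen lambda a + dombi_gen lambda x).
Proof. by move=> a0 x0; rewrite /dombi !gt_eqF. Qed.

Lemma dombiVE {R : realType} (lambda b a : R) :
  dombiV lambda b a
  = dombi_geninv lambda (dombi_gen lambda b - dombi_gen lambda a).
Proof. by []. Qed.

Lemma dombiV_gt0 {R : realType} (lambda b a : R) : 0 < dombiV lambda b a.
Proof. exact: dombi_geninv_gt0. Qed.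

Lemma dombi0r {R : realType} (lambda a : R) : dombi lambda a 0 = 0.
Proof. by rewrite /dombi eqxx orbT. Qed.

Lemma dombi0l {R : realType} (lambda x : R) : dombi lambda 0 x = 0.
Proof. by rewrite /dombi eqxx. Qed.

Lemma dombi_ge0 {R : realType} (lambda a x : R) : 0 <= dombi lambda a x.
Proof. by rewrite /dombi; case: ifP => // _; apply/ltW/dombi_geninv_gt0. Qed.

Lemma dombi_gt0 {R : realType} (lambda a x : R) : 0 < a -> 0 < x ->
  0 < dombi lambda a x.
Proof. by move=> a0 x0; rewrite dombiE// dombi_geninv_gt0. Qed.

(** Adding the nonnegative term G x to G a can only lower the image under the decreasing G^-1. *)
Lemma dombi_lel {R : realType} {lambda a x : R} : 0 < lambda ->
  0 <= a <= 1 -> 0 <= x <= 1 -> dombi lambda a x <= a.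
Proof.
move=> l0 /andP[a0 a1] /andP[x0 x1].
move: a0; rewrite le_eqVlt => /predU1P[<-|a0]; first by rewrite dombi0l.
move: x0; rewrite le_eqVlt => /predU1P[<-|x0]; first by rewrite dombi0r ltW.
have a01 : 0 < a <= 1 by rewrite a0.
rewrite dombiE // -{2}(dombi_genK l0 a01) ler_dombi_geninv //.
- by rewrite lerDl dombi_gen_ge0.
- by rewrite nnegrE addr_ge0 ?dombi_gen_ge0.
- by rewrite nnegrE dombi_gen_ge0.
Qed.

(** Keeps the argument of G^-1 in V(b, a) inside the half-line where G^-1 is known to be
    monotone. *)
Lemma dombi_gen_subr_ge0 {R : realType} {lambda b a : R} : 0 < lambda ->
  0 < b -> b <= a <= 1 -> 0 <= dombi_gen lambda b - dombi_gen lambda a.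
Proof.
move=> l0 b0 /andP[ba a1].
by rewrite subr_ge0 ler_dombi_gen ?b0 ?(lt_le_trans b0 ba) ?(le_trans ba).
Qed.

(** For x > 0 both sides amount to G a + G x <= G b; for x = 0 both fail, because b and V(b, a) are
    positive. *)
Lemma dombi_geV {R : realType} {lambda b a x : R} : 0 < lambda ->
  0 < b -> b <= a <= 1 -> 0 <= x <= 1 ->
  (b <= dombi lambda a x) = (dombiV lambda b a <= x).
Proof.
move=> l0 b0 ba1 /andP[x0 x1]; have /andP[ba a1] := ba1.
have a0 := lt_le_trans b0 ba.
move: x0; rewrite le_eqVlt => /predU1P[<-|x0].
  by rewrite dombi0r !leNgt b0 dombiV_gt0.
have b01 : 0 < b <= 1 by rewrite b0 (le_trans ba).
have x01 : 0 < x <= 1 by rewrite x0.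
rewrite dombiE // dombiVE -{1}(dombi_genK l0 b01) -{2}(dombi_genK l0 x01).
rewrite !ler_dombi_geninv ?nnegrE ?dombi_gen_subr_ge0 ?addr_ge0 ?dombi_gen_ge0 //.
by rewrite lerBrDl.
Qed.

Lemma dombi_leV {R : realType} {lambda b a x : R} : 0 < lambda ->
  0 < b -> b <= a <= 1 -> 0 <= x <= 1 ->
  (dombi lambda a x <= b) = (x <= dombiV lambda b a).
Proof.
move=> l0 b0 ba1 /andP[x0 x1]; have /andP[ba a1] := ba1.
have a0 := lt_le_trans b0 ba.
move: x0; rewrite le_eqVlt => /predU1P[<-|x0].
  by rewrite dombi0r !ltW ?dombiV_gt0.
have b01 : 0 < b <= 1 by rewrite b0 (le_trans ba).
have x01 : 0 < x <= 1 by rewrite x0.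
rewrite dombiE // dombiVE -{1}(dombi_genK l0 b01) -{2}(dombi_genK l0 x01).
rewrite !ler_dombi_geninv ?nnegrE ?dombi_gen_subr_ge0 ?addr_ge0 ?dombi_gen_ge0 //.
by rewrite lerBlDl.
Qed.

(** The three cases of [xhat] are the three ways the constraint acts: it is a residual bound when 0
    < b_i <= a_ij, forces x = 0 when a_ij > b_i = 0, and is vacuous when a_ij < b_i or a_ij = b_i =
    0. *)
Lemma dombi_le_xhat {R : realType} {m n : nat} (lambda : R) (A : 'M[R]_(m, n))
    (b : 'cV[R]_m) (i : 'I_m) (j : 'I_n) (x : R) : 0 < lambda ->
  0 <= A i j <= 1 -> 0 <= b i ord0 -> 0 <= x <= 1 ->
  (dombi lambda (A i j) x <= b i ord0) = (x <= xhat lambda A b i j ord0).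
Proof.
move=> l0 a01 b0 x01; have /andP[a0 a1] := a01; have /andP[x0 x1] := x01.
rewrite mxE inE; have [ba|ab] /= := leP (b i ord0) (A i j); last first.
  by rewrite x1 (le_trans (dombi_lel l0 a01 x01)) // ltW.
have [bi0|bi_neq0] /= := eqVneq (b i ord0) 0; last first.
  by rewrite dombi_leV ?ba // lt0r bi_neq0.
rewrite bi0 andbT; case: ifPn => [a_gt0|]; last first.
  rewrite -leNgt => a_le0; have -> : A i j = 0 by apply/le_anti/andP.
  by rewrite dombi0l lexx x1.
move: x0; rewrite le_eqVlt => /predU1P[<-|x0]; first by rewrite dombi0r.
by rewrite !leNgt x0 dombi_gt0.
Qed.

Lemma maxdombi_leP {R : realType} {m n : nat} (lambda : R) (A : 'M[R]_(m, n))
    (b : 'cV[R]_m) (x : 'cV[R]_n) : 0 < lambda ->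
  (forall i j, 0 <= A i j <= 1) -> cube b -> cube x ->
  lecv (maxdombi lambda A x) b <-> lecv x (Xmax lambda A b).
Proof.
move=> l0 A01 b01 x01.
have b0 i : 0 <= b i ord0 by case/andP: (b01 i).
split=> [le_b j|le_x i]; rewrite mxE.
(* The initial value 1 of the minimum is harmless since x lies in the cube. *)
- apply: le_bigmin => [|i _]; first by case/andP: (x01 j).
  rewrite -dombi_le_xhat //; apply: le_trans (le_b i).
  by rewrite mxE (le_bigmax 0 (fun j => dombi lambda (A i j) (x j ord0))).
- apply: bigmax_le => // j _; rewrite dombi_le_xhat //.
  apply: le_trans (le_x j) _; rewrite mxE.
  exact: (bigmin_le 1 i (fun i => xhat lambda A b i j ord0)).
Qed.

(** A zeroed entry can stay in [Jbar] only if b_i <= 0, and then a_ij >= 0 already suffices. *)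
Lemma Jbar_subset {R : realType} {m n : nat} (lambda : R) (A : 'M[R]_(m, n))
    (b : 'cV[R]_m) (i : 'I_m) (j : 'I_n) :
  0 <= A i j -> j \in Jbar lambda A b i -> j \in Jset A b i.
Proof.
move=> a0; rewrite !inE mxE; case: ifP => // _ b_le0; exact: le_trans a0.
Qed.

Lemma Jbar0 {R : realType} {m n : nat} (lambda : R) (A : 'M[R]_(m, n))
    (b : 'cV[R]_m) (i : 'I_m) (j : 'I_n) :
  0 <= A i j -> b i ord0 = 0 -> j \in Jbar lambda A b i.
Proof. by move=> a0 bi0; rewrite inE mxE bi0; case: ifP. Qed.

Lemma Jbar_attained {R : realType} {m n : nat} (lambda : R)
    (A : 'M[R]_(m, n)) (b : 'cV[R]_m) (x : 'cV[R]_n) (i : 'I_m) (j : 'I_n) :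
  0 < lambda -> (forall i j, 0 <= A i j <= 1) -> cube b -> cube x ->
  lecv x (Xmax lambda A b) -> b i ord0 != 0 ->
  b i ord0 <= dombi lambda (A i j) (x j ord0) -> j \in Jbar lambda A b i.
Proof.
move=> l0 A01 b01 x01 le_x bi_neq0 le_dombi.
have bi_gt0 : 0 < b i ord0 by rewrite lt0r bi_neq0; case/andP: (b01 i).
have ba : b i ord0 <= A i j by apply: le_trans le_dombi (dombi_lel l0 _ _).
have V_le_x : dombiV lambda (b i ord0) (A i j) <= x j ord0.
  by rewrite -dombi_geV // ba; case/andP: (A01 i j).
have x_le_xhat i' : x j ord0 <= xhat lambda A b i' j ord0.
  apply: le_trans (le_x j) _; rewrite mxE.
  exact: (bigmin_le 1 i' (fun i => xhat lambda A b i j ord0)).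
rewrite inE mxE ifN //; rewrite /reducible !negb_or inE ba bi_neq0 /=.
apply/andP; split; apply/negP => /existsP[i' /and3P[_]].
(* Rule (II) fails: V(b_i, a_ij) <= x_j <= V(b_i', a_i'j). *)
- move=> jJ /andP[bi'_neq0]; rewrite ltNge => /negP; apply.
  by apply: le_trans V_le_x _; have := x_le_xhat i'; rewrite mxE jJ bi'_neq0.
(* Rule (III) would force x_j <= 0, against 0 < V(b_i, a_ij) <= x_j. *)
- move=> /eqP bi'0 a'_gt0; have := x_le_xhat i'.
  rewrite mxE inE bi'0 eqxx a'_gt0 (ltW a'_gt0) /= => x_le0.
  by have := le_trans V_le_x x_le0; rewrite leNgt dombiV_gt0.
Qed.

Theorem corollary3 (R : realType) (m n : nat) (m_gt0 : (0 < m)%N)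
    (n_gt0 : (0 < n)%N) (lambda : R) (lambda_gt0 : 0 < lambda)
    (A : 'M[R]_(m, n)) (A01 : forall i j, 0 <= A i j <= 1)
    (b : 'cV[R]_m) (b01 : cube b) :
  solutions lambda A b
  = \bigcup_(e in Ebar lambda A b) box (Xmin lambda A b e) (Xmax lambda A b).
Proof.
have A0 i j : 0 <= A i j by case/andP: (A01 i j).
apply/seteqP; split => x /=.
- move=> [x01 Axb].
  have le_x : lecv x (Xmax lambda A b).
    by apply/maxdombi_leP => // i; rewrite Axb.
  (* A sigma type rather than an existential, so that the function e can be read off by projection;
     the maximum is reached at an index because n > 0 and all terms are at least the initial value
     0. *)
  have attained i : {j | b i ord0 <= dombi lambda (A i j) (x j ord0)}.
    have [|j _ max_j] :=
      @eq_bigmax _ _ _ 0 (Ordinal n_gt0) predT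
        (fun j => dombi lambda (A i j) (x j ord0)) isT.
      by move=> j _; apply: dombi_ge0.
    by exists j; rewrite -max_j -Axb mxE.
  exists (fun i => sval (attained i)).
    move=> i /=; case: (attained i) => j /= le_dombi.
    have [bi0|bi_neq0] := eqVneq (b i ord0) 0; first exact: Jbar0.
    exact: Jbar_attained le_dombi.
  split=> // j; rewrite mxE; have /andP[xj0 _] := x01 j.
  apply: bigmax_le => // i _; rewrite mxE; case: ifP => // /andP[bi_neq0].
  case: (attained i) => k /= le_dombi /eqP ->.
  have bi_gt0 : 0 < b i ord0 by rewrite lt0r bi_neq0; case/andP: (b01 i).
  rewrite -dombi_geV //; apply/andP; split; last by case/andP: (A01 i k).
  exact: le_trans le_dombi (dombi_lel _ _ _).
- move=> [e eE [x01 ge_x le_x]]; split=> //.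
  have le_b := (maxdombi_leP lambda A b x lambda_gt0 A01 b01 x01).2 le_x.
  apply/colP => i; apply/le_anti/andP; split; first exact: le_b.
  (* If b_i = 0, any term of the maximum gives the lower bound; otherwise the term at [e i] does, by
     [dombi_geV]. *)
  have [bi0|bi_neq0] := eqVneq (b i ord0) 0.
    rewrite bi0 mxE.
    apply: le_trans (le_bigmax _ _ (Ordinal n_gt0)); exact: dombi_ge0.
  have bi_gt0 : 0 < b i ord0 by rewrite lt0r bi_neq0; case/andP: (b01 i).
  have := Jbar_subset lambda A b i (e i) (A0 _ _) (eE i); rewrite inE => ba.
  rewrite mxE; apply: le_trans (le_bigmax _ _ (e i)).
  rewrite dombi_geV ?ba //; last by case/andP: (A01 i (e i)).
  apply: le_trans (ge_x (e i)); rewrite mxE.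
  apply: le_trans (le_bigmax _ _ i).
  by rewrite mxE bi_neq0 eqxx.
Qed.
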